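(* Let $K$ be a positive integer, let $p$ be a prime number, and let $\varepsilon$ and $\kappa$ be positive real numbers with $\kappa<1$. For $k=1,\ldots,K$, let $\{a_{k,n}\}_{n=1}^\infty$ and $\{b_{k,n}\}_{n=1}^\infty$ be sequences of non-zero integers with $p\nmid\gcd(a_{k,n},b_{k,n})$, and set $a_{0,n}=1$ for all $n$. Suppose that for each $k=1,\ldots,K$: for each sufficiently large $N$ there is exactly one $n\le N$ with $\nu_p(a_{k,n})=\max_{1\le m\le N}\nu_p(a_{k,m})$, and \[\lim_{N\to\infty}\frac{\max_{1\le n\le N}\nu_p(a_{k,n})}{1+\max_{1\le n\le N}\nu_p(a_{k-1,n})}=\infty.\] Suppose there is a non-decreasing sequence $\{a_n\}_{n=1}^\infty$ of positive integers and an integer $A_0$ such that for each $k=1,\ldots,K$, each integer $A\ge A_0$ and all sufficiently large $n$: \[ n^{1+\varepsilon}\le a_n\le a_{n+1},\qquad |b_{k,n}|\le 2^{(\log_2 a_n)^\kappa},\] \[ a_n2^{-(\log_2 a_n)^\kappa}\le |a_{k,n}|\le \max\big\{a_n2^{(\log_2 a_n)^\kappa},\,2^{A^n}\big\},\] and for each integer $A\ge A_0$, $\limsup_{n\to\infty}a_n^{1/A^n}=\infty$. For $k=1,\ldots,K$ set $\alpha_k=\sum_{n=1}^\infty\frac{b_{k,n}}{a_{k,n}}$. Then $\alpha_1,\ldots,\alpha_K$ are algebraically independent over $\mathbb Q$.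
   Context: For a prime $p$ and integer $n$, $\nu_p(n)$ denotes the $p$-adic valuation of $n$ (with $\nu_p(0)=\infty$). *)

(* Defs.v *)
From Stdlib Require Import Reals ZArith.
From mathcomp Require Import all_boot all_algebra.
From mathcomp Require Import Rstruct.
From mathcomp Require Import mpoly.

Set Implicit Arguments.
Unset Strict Implicit.
Unset Printing Implicit Defensive.

Definition nu (p : nat) (z : Z) : nat := logn p (Z.abs_nat z).

Definition maxnu (p : nat) (a : nat -> Z) (N : nat) : nat :=
  \max_(1 <= m < N.+1) nu p (a m).

Local Open Scope R_scope.
Definition log2 (x : R) : R := ln x / ln 2.

Local Close Scope R_scope.
Definition alg_indep (K : nat) (x : 'I_K -> R) : Prop :=
  forall P : {mpoly rat[K]}, P != 0%R ->
    (map_mpoly (ratr : rat -> R) P).@[x] <> 0%R.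

(* Main.v *)
Require Import Defs.
From Stdlib Require Import Reals ZArith Lra Lia.
From mathcomp Require Import all_boot all_order all_algebra.
From mathcomp Require Import Rstruct.
From mathcomp Require Import mpoly.
From mathcomp Require Import zify ssrZ.

(** Let [x N] be the vector of the [N]-th partial sums and suppose [P alpha = 0]
    with [P != 0] over the rationals.  The uniqueness of the maximal p-adic
    valuation gives [x N k] the valuation [- max_(n <= N) nu_p (a k n)], and since
    these maxima grow faster and faster in [k], the monomials of [P] take pairwise
    distinct valuations at [x N]; hence [P (x N) != 0] for large [N], and [|P (x N)|]
    is at least the inverse of a fixed power of the product of all denominators.
    On the other hand [|P (x N)| = |P (x N) - P alpha|] is at most a constant times
    [a_(N+1) ^ (- eta)].  With [L n = log2 a_n] the two bounds combine to
    [eta * L (N+1) <= c + d * \sum_(n <= N) (2 L n + A ^ n)] for all large [N], which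
    forces [L n = O(B ^ n)] for every large [B], against the limsup hypothesis. *)

Set Implicit Arguments.
Unset Strict Implicit.
Unset Printing Implicit Defensive.

Import Order.TTheory GRing.Theory Num.Theory.

Section PadicValuation.
Local Open Scope ring_scope.
Variable p : nat.

(* Junk values: [pval 0 = 0], and [pval] vanishes identically when [p] is not prime. *)
Definition pval (q : rat) : int :=
  (logn p `|numq q|)%:Z - (logn p `|denq q|)%:Z.

Lemma pval0 : pval 0 = 0.
Proof. by rewrite /pval -[0]/(0%:Q) numq_int denq_int logn0 logn1. Qed.

Lemma pval_frac (n d : int) : n != 0 -> d != 0 ->
  pval (n%:~R / d%:~R) = (logn p `|n|)%:Z - (logn p `|d|)%:Z.
Proof.
move=> n0 d0; set q : rat := _ / _.
have q0 : numq q != 0 by rewrite numq_eq0 mulf_neq0 ?invr_eq0 ?intr_eq0.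
have cross : numq q * d = n * denq q.
  apply: (@intr_inj rat); rewrite !rmorphM /= numqE mulrAC divfK //.
  by rewrite intr_eq0.
have := congr1 (fun z : int => logn p `|z|) cross.
rewrite /= !abszM !lognM ?absz_gt0 ?denq_eq0 // /pval; lia.
Qed.

Lemma pval_int (z : int) : z != 0 -> pval z%:~R = logn p `|z|.
Proof.
by move=> z0; rewrite -[z%:~R]divr1 (pval_frac z0 (oner_neq0 int)) logn1 subr0.
Qed.

Lemma pvalM x y : x != 0 -> y != 0 -> pval (x * y) = pval x + pval y.
Proof.
move=> x0 y0.
have -> : x * y = (numq x * numq y)%:~R / (denq x * denq y)%:~R.
  by rewrite !rmorphM -mulf_div !divq_num_den.
rewrite pval_frac ?mulf_neq0 ?numq_eq0 ?denq_eq0 //.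
rewrite !abszM !lognM ?absz_gt0 ?numq_eq0 ?denq_eq0 // /pval; lia.
Qed.

Lemma pvalN x : pval (- x) = pval x.
Proof. by rewrite /pval numqN denqN abszN. Qed.

Lemma pvalV x : pval x^-1 = - pval x.
Proof.
have [->|x0] := eqVneq x 0; first by rewrite invr0 pval0.
rewrite -[x in LHS]divq_num_den invf_div pval_frac ?denq_eq0 ?numq_eq0 //.
by rewrite opprB.
Qed.

Lemma pval_prod (I : eqType) (r : seq I) (x : I -> rat) :
  (forall i, x i != 0) -> pval (\prod_(i <- r) x i) = \sum_(i <- r) pval (x i).
Proof.
move=> x0; elim: r => [|i r IHr].
  by rewrite !big_nil (pval_int (oner_neq0 int)) logn1.
by rewrite !big_cons pvalM ?IHr // prodf_seq_neq0; apply/allP => j _; rewrite x0.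
Qed.

Lemma pvalX x n : x != 0 -> pval (x ^+ n) = pval x *+ n.
Proof.
move=> x0; rewrite -[n in LHS]card_ord -prodr_const pval_prod //.
by rewrite sumr_const card_ord.
Qed.

Lemma logn_abszD_ge (x y : int) : x + y != 0 ->
  (minn (logn p `|x|) (logn p `|y|) <= logn p `|(x + y)%R|)%N.
Proof.
move=> xy0; have [->|x0] := eqVneq x 0; first by rewrite add0r geq_minr.
have [->|y0] := eqVneq y 0; first by rewrite addr0 geq_minl.
case p_prime: (prime p); last first.
  have logn_eq0 z : logn p z = 0%N by rewrite lognE p_prime.
  by rewrite !logn_eq0.
rewrite -pfactor_dvdn ?absz_gt0 //; set d := (p ^ _)%N.
have dx : (d %| `|x|)%N by rewrite pfactor_dvdn ?absz_gt0 ?geq_minl.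
have dy : (d %| `|y|)%N by rewrite pfactor_dvdn ?absz_gt0 ?geq_minr.
by rewrite -[d]/`|d%:Z|%N -dvdzE rpredD // dvdzE.
Qed.

Lemma pvalD_ge x y : x + y != 0 -> Num.min (pval x) (pval y) <= pval (x + y).
Proof.
have [->|x0] := eqVneq x 0; first by rewrite add0r ge_min lexx orbT.
have [->|y0] := eqVneq y 0; first by rewrite addr0 ge_min lexx.
have nz := (numq_eq0, denq_eq0).
have dx0 : denq x != 0 by rewrite denq_eq0.
have dy0 : denq y != 0 by rewrite denq_eq0.
pose n := numq x * denq y + numq y * denq x.
have sumE : x + y = n%:~R / (denq x * denq y)%:~R.
  by rewrite rmorphD !rmorphM -addf_div ?intr_eq0 // !divq_num_den.
move=> xy0; have n0 : n != 0.
  by apply: contraNneq xy0 => n0; rewrite sumE n0 mul0r.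
have := logn_abszD_ge n0; rewrite -/n sumE pval_frac ?mulf_neq0 //.
rewrite !abszM !lognM ?absz_gt0 ?nz // /pval; lia.
Qed.

Lemma pval_lt_addr_neq0 x y : x != 0 -> pval x < pval y -> x + y != 0.
Proof.
move=> x0; apply: contraTneq => /eqP.
by rewrite addr_eq0 => /eqP ->; rewrite pvalN ltxx.
Qed.

Lemma pvalDl x y : x != 0 -> pval x < pval y -> pval (x + y) = pval x.
Proof.
move=> x0 lt_xy; have s0 := pval_lt_addr_neq0 x0 lt_xy.
have := pvalD_ge s0; rewrite (min_l (ltW lt_xy)) => s_ge.
have : Num.min (pval (x + y)) (pval y) <= pval x.
  by rewrite -(pvalN y) -{2}(addrK y x) pvalD_ge // addrK.
by rewrite ge_min (lt_geF lt_xy) orbF => s_le; apply: le_anti; rewrite s_le.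
Qed.

Lemma pval_sum_ge (I : eqType) (r : seq I) (t : I -> rat) e :
  {in r, forall i, e <= pval (t i)} -> \sum_(i <- r) t i != 0 ->
  e <= pval (\sum_(i <- r) t i).
Proof.
elim: r => [|i s IHs] ge_e; rewrite ?big_nil ?eqxx // big_cons => sum0.
have ge_s : {in s, forall j, e <= pval (t j)}.
  by move=> j js; apply: ge_e; rewrite inE js orbT.
have ge_i : e <= pval (t i) by apply: ge_e; rewrite mem_head.
have [->|rest0] := eqVneq (\sum_(j <- s) t j) 0; first by rewrite addr0.
by apply: le_trans (pvalD_ge sum0); rewrite le_min ge_i IHs.
Qed.

Lemma pval_sum_unique_min (I : eqType) (r : seq I) (t : I -> rat) j :
  uniq r -> j \in r -> t j != 0 ->
  {in r, forall i, i != j -> pval (t j) < pval (t i)} ->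
  pval (\sum_(i <- r) t i) = pval (t j).
Proof.
move=> ur jr tj0 min_j; rewrite (bigD1_seq j) //= -big_filter.
set rest := \sum_(i <- _) _; have [->|rest0] := eqVneq rest 0; first by rewrite addr0.
apply: pvalDl => //; rewrite -lezD1 pval_sum_ge // => i.
by rewrite mem_filter lezD1 => /andP [ij ir]; apply: min_j.
Qed.

Lemma sum_neq0_of_pval_injective (I : eqType) (r : seq I) (t : I -> rat) :
  uniq r -> r != [::] -> {in r, forall i, t i != 0} ->
  {in r &, injective (pval \o t)} -> \sum_(i <- r) t i != 0.
Proof.
move=> ur r0 t0 inj_t.
suff [] : \sum_(i <- r) t i != 0 /\
  exists2 j, j \in r & pval (\sum_(i <- r) t i) = pval (t j) by [].
elim: r ur r0 t0 inj_t => // i s IHs /= /andP [i_s us] _ t0 inj_t.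
have ti0 : t i != 0 by apply: t0; rewrite mem_head.
have [->|s0] := eqVneq s [::].
  by rewrite big_seq1; split=> //; exists i; rewrite ?mem_head.
have [j js|j k js ks|sum0 [j js sum_j]] := IHs us s0.
- by apply: t0; rewrite inE js orbT.
- by apply: inj_t; rewrite inE ?js ?ks orbT.
rewrite big_cons; have [lt_ij|lt_ji|eq_ij] := ltgtP (pval (t i)) (pval (t j)).
- have lt_sum : pval (t i) < pval (\sum_(k <- s) t k) by rewrite sum_j.
  split; first exact: pval_lt_addr_neq0.
  by exists i; rewrite ?mem_head ?pvalDl.
- have lt_sum : pval (\sum_(k <- s) t k) < pval (t i) by rewrite sum_j.
  rewrite addrC; split; first exact: pval_lt_addr_neq0.
  by exists j; rewrite ?inE ?js ?orbT ?pvalDl.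
- have /inj_t : (pval \o t) i = (pval \o t) j by [].
  by rewrite mem_head inE js orbT => /(_ isT isT) ij; rewrite ij js in i_s.
Qed.

End PadicValuation.

Section PolynomialEvaluation.
Local Open Scope ring_scope.

Lemma mnm_le_mdeg K (m : 'X_{1..K}) i : (m i <= mdeg m)%N.
Proof. by rewrite mdegE (bigD1 i) //= leq_addr. Qed.

Lemma meval_map_mpoly K (R S : comNzRingType) (f : {rmorphism R -> S})
    (P : {mpoly R[K]}) (x : 'I_K -> R) :
  (map_mpoly f P).@[fun i => f (x i)] = f P.@[x].
Proof.
rewrite /map_mpoly !raddf_sum /=; apply: eq_bigr => m _.
rewrite mevalM mevalC mmap1_id mevalX rmorphM rmorph_prod.
by congr (_ * _); apply: eq_bigr => i _; rewrite rmorphXn.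
Qed.

Section LipschitzOnBox.
Variables (K : nat) (F : numFieldType) (B : F).

Definition in_box (x : 'I_K -> F) : Prop := forall i, `|x i| <= B.

Definition bounded_lipschitz (P : {mpoly F[K]}) : Prop :=
  exists2 C : F, 0 < C &
    (forall x, in_box x -> `|P.@[x]| <= C) /\
    (forall x y d, in_box x -> in_box y -> 0 <= d ->
       (forall i, `|x i - y i| <= d) -> `|P.@[x] - P.@[y]| <= C * d).

Lemma bounded_lipschitzC c : bounded_lipschitz c%:MP.
Proof.
exists (`|c| + 1); first by rewrite ltr_wpDl.
split=> [x _|x y d _ _ d0 _]; first by rewrite mevalC lerDl.
by rewrite !mevalC subrr normr0 mulr_ge0 // addr_ge0.
Qed.

Lemma bounded_lipschitzXU i : bounded_lipschitz 'X_i.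
Proof.
exists (`|B| + 1); first by rewrite ltr_wpDl.
split=> [x /(_ i) xB|x y d _ _ d0 /(_ i) xy_d].
  have B0 : 0 <= B by exact: le_trans xB.
  by rewrite mevalXU (le_trans xB) // ger0_norm // lerDl.
by rewrite !mevalXU (le_trans xy_d) // ler_peMl // lerDr.
Qed.

Lemma bounded_lipschitzD P Q :
  bounded_lipschitz P -> bounded_lipschitz Q -> bounded_lipschitz (P + Q).
Proof.
move=> [CP CP0 [bP lP]] [CQ CQ0 [bQ lQ]]; exists (CP + CQ); first exact: addr_gt0.
split=> [x xB|x y d xB yB d0 xy_d]; rewrite !mevalD.
  by rewrite (le_trans (ler_normD _ _)) // lerD ?bP ?bQ.
by rewrite opprD addrACA mulrDl (le_trans (ler_normD _ _)) // lerD ?lP ?lQ.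
Qed.

Lemma bounded_lipschitzM P Q :
  bounded_lipschitz P -> bounded_lipschitz Q -> bounded_lipschitz (P * Q).
Proof.
move=> [CP CP0 [bP lP]] [CQ CQ0 [bQ lQ]]; exists (CP * CQ *+ 2).
  by rewrite pmulrn_lgt0 // mulr_gt0.
split=> [x xB|x y d xB yB d0 xy_d]; rewrite !mevalM.
  by rewrite normrM mulr2n ler_wpDr ?ler_pM ?bP ?bQ // mulr_ge0 ?ltW.
have -> : P.@[x] * Q.@[x] - P.@[y] * Q.@[y] =
    (P.@[x] - P.@[y]) * Q.@[x] + P.@[y] * (Q.@[x] - Q.@[y]).
  by rewrite mulrBl mulrBr addrA subrK.
rewrite (le_trans (ler_normD _ _)) // !normrM mulr2n mulrDl lerD //.
  by rewrite mulrAC ler_pM ?lP ?bQ.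
by rewrite -mulrA ler_pM ?lQ ?bP.
Qed.

Lemma meval_bounded_lipschitz P : bounded_lipschitz P.
Proof.
rewrite (mpolyE P); apply: big_ind => [||m _].
- by rewrite -mpolyC0; apply: bounded_lipschitzC.
- exact: bounded_lipschitzD.
rewrite -mul_mpolyC; apply: bounded_lipschitzM; first exact: bounded_lipschitzC.
rewrite mpolyXE_id; apply: big_ind => [||i _].
- by rewrite -mpolyC1; apply: bounded_lipschitzC.
- exact: bounded_lipschitzM.
elim: (m i) => [|n IHn].
  by rewrite expr0 -mpolyC1; apply: bounded_lipschitzC.
by rewrite exprS; apply: bounded_lipschitzM => //; apply: bounded_lipschitzXU.
Qed.

End LipschitzOnBox.

Definition is_common_denominator K (x : 'I_K -> rat) (D : rat) : Prop :=
  [/\ D \is a Num.int, D != 0 & forall i, x i * D \is a Num.int].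

Lemma meval_norm_lower_bound K (P : {mpoly rat[K]}) :
  exists2 c : rat, 0 < c & forall (x : 'I_K -> rat) (D : rat),
    is_common_denominator x D -> P.@[x] != 0 ->
    1 <= `|P.@[x]| * (c * `|D| ^+ msize P).
Proof.
pose c : rat := \prod_(m <- msupp P) (denq P@_m)%:~R.
have c0 : 0 < c by apply: prodr_gt0 => m _; rewrite ltr0z denq_gt0.
exists c => // x D [Dint D0 xDint] Px0.
rewrite -(gtr0_norm c0) -normrX -!normrM norm_intr_ge1 //; last first.
  by rewrite !mulf_neq0 ?expf_neq0 // gt_eqF.
rewrite mevalE mulr_suml big_seq rpred_sum // => m mP.
rewrite mulrACA rpredM //.
  rewrite /c (big_rem m mP) /= mulrA -numqE rpredM ?intr_int //.
  by rewrite rpred_prod // => m' _; rewrite intr_int.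
rewrite -(subnKC (ltnW (msize_mdeg_lt mP))) exprD mulrA rpredM ?rpredX //.
rewrite mdegE -prodrXr -big_split rpred_prod //= => i _.
by rewrite -exprMn rpredX.
Qed.

(* Liouville's argument: [P x] is a nonzero rational with bounded denominator, yet it is
   within a constant times [d] of [P alpha = 0]. *)
Lemma root_approximation_lower_bound K (F : numFieldType) (P : {mpoly rat[K]})
    (alpha : 'I_K -> F) (d0 : F) :
  (map_mpoly ratr P).@[alpha] = 0 ->
  exists2 C : F, 0 < C & forall (x : 'I_K -> rat) (D : rat) (d : F),
    is_common_denominator x D -> P.@[x] != 0 ->
    0 <= d <= d0 -> (forall i, `|ratr (x i) - alpha i| <= d) ->
    1 <= C * d * `|ratr D| ^+ msize P.
Proof.
move=> Palpha; have [c c0 denP] := meval_norm_lower_bound P.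
pose B := \sum_i `|alpha i| + d0.
have [C C0 [_ lipP]] := meval_bounded_lipschitz B (map_mpoly (ratr : rat -> F) P).
exists (C * ratr c) => [|x D d xD Px0 /andP [d_ge0 d_le] near].
  by rewrite mulr_gt0 ?ltr0q.
have alpha_le i : `|alpha i| <= \sum_i `|alpha i|.
  by rewrite (bigD1 i) //= lerDl sumr_ge0.
have alphaB : in_box B alpha.
  by move=> i; rewrite (le_trans (alpha_le i)) // lerDl (le_trans d_ge0).
have xB : in_box B (fun i => ratr (x i)).
  move=> i; rewrite -[ratr (x i)](subrK (alpha i)) addrC (le_trans (ler_normD _ _)) //.
  by rewrite lerD // (le_trans (near i)).
have := lipP _ _ _ xB alphaB d_ge0 near; rewrite Palpha subr0 meval_map_mpoly => Px_le.
have := denP x D xD Px0.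
rewrite -(ler_rat F) rmorph1 => /le_trans; apply.
rewrite !rmorphM rmorphXn /= !ratr_norm (mulrAC C) -(mulrA (C * d)).
by rewrite ler_wpM2r // mulr_ge0 ?exprn_ge0 // ler0q ltW.
Qed.

End PolynomialEvaluation.

Definition eventually (Q : nat -> Prop) : Prop :=
  exists n0, forall n, (n0 <= n)%N -> Q n.

Lemma eventually_ge n0 : eventually (fun n => (n0 <= n)%N).
Proof. by exists n0. Qed.

Lemma eventually_and (Q1 Q2 : nat -> Prop) :
  eventually Q1 -> eventually Q2 -> eventually (fun n => Q1 n /\ Q2 n).
Proof.
move=> [n1 ev1] [n2 ev2]; exists (maxn n1 n2) => n.
by rewrite geq_max => /andP [/ev1 ? /ev2].
Qed.

Lemma eventually_forall (I : finType) (Q : I -> nat -> Prop) :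
  (forall i, eventually (Q i)) -> eventually (fun n => forall i, Q i n).
Proof.
move=> /fin_all_exists [n0 evQ]; exists (\max_i n0 i) => n n_ge i.
by apply: evQ; apply: leq_trans n_ge; apply: leq_bigmax.
Qed.

Section LacunaryWeights.
Variables (K M : nat) (V : nat -> nat).

Definition lacunary : Prop := forall k, (k < K)%N -> (M * (1 + V k) <= V k.+1)%N.

Definition weight (m : 'X_{1..K}) : nat := \sum_(i < K) V i.+1 * m i.

Hypothesis lacunaryV : lacunary.

Lemma lacunary_homo k l : (0 < M)%N -> (k <= l <= K)%N -> (V k <= V l)%N.
Proof.
move=> M0; elim: l => [|l IHl]; first by rewrite leqn0 => /andP [/eqP ->].
rewrite leq_eqVlt => /andP [/predU1P [-> //|kl] lK].
have V_kl : (V k <= V l)%N by rewrite IHl // -ltnS kl ltnW.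
apply: leq_trans V_kl (leq_trans _ (lacunaryV lK)).
by rewrite (leq_trans _ (leq_pmull _ M0)) // leq_addl.
Qed.

(* The single extra factor [V j.+1] outweighs the lower weights and [C] together. *)
Lemma lacunary_weight_lt d C (m m' : 'X_{1..K}) (j : 'I_K) :
  (K * d + C < M)%N -> (mdeg m <= d)%N -> (m j < m' j)%N ->
  (forall i : 'I_K, (j < i)%N -> m i = m' i) -> (weight m + C < weight m')%N.
Proof.
move=> gapM dm ltj above; have M0 : (0 < M)%N by exact: leq_ltn_trans gapM.
pose rest (n : 'X_{1..K}) := (\sum_(i < K | i != j) V i.+1 * n i)%N.
have weightE n : weight n = (V j.+1 * n j + rest n)%N by rewrite /weight (bigD1 j).
have lower : (rest m <= rest m' + K * (d * V j))%N.
  apply: (@leq_trans (\sum_(i < K | i != j) (V i.+1 * m' i + d * V j))%N).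
    apply: leq_sum => i ij; have [lt_ij|lt_ji|/val_inj eq_ij] := ltngtP i j.
    - rewrite mulnC (leq_trans _ (leq_addl _ _)) // leq_mul //.
        exact: leq_trans (mnm_le_mdeg m i) dm.
      by rewrite lacunary_homo // lt_ij ltnW.
    - by rewrite above // leq_addr.
    - by rewrite eq_ij eqxx in ij.
  rewrite big_split leq_add2l sum_nat_const leq_mul2r.
  by rewrite (leq_trans (max_card _)) ?card_ord ?orbT.
have top : (V j.+1 * m j + V j.+1 <= V j.+1 * m' j)%N.
  by rewrite addnC -mulnS leq_mul2l ltj orbT.
have gap : (K * (d * V j) + C < V j.+1)%N.
  apply: leq_trans (lacunaryV (ltn_ord j)); rewrite mulnDr muln1 mulnA -addSn.
  have : (K * d * V j <= M * V j)%N by rewrite leq_mul2r; apply/orP; right; lia.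
  lia.
rewrite !weightE; lia.
Qed.

Lemma lacunary_weight_separated d C (m m' : 'X_{1..K}) :
  (K * d + C < M)%N -> (mdeg m <= d)%N -> (mdeg m' <= d)%N -> m != m' ->
  (weight m + C < weight m')%N \/ (weight m' + C < weight m)%N.
Proof.
move=> gapM dm dm' neq_mm'.
have [i0 neq_i0] : exists i, m i != m' i.
  apply/existsP; apply: contraNT neq_mm'; rewrite negb_exists => /forallP eq_mm'.
  by apply/eqP/mnmP => i; apply/eqP; rewrite -[_ == _]negbK.
have [j neq_j max_j] := @arg_maxnP _ i0 (fun i => m i != m' i) val neq_i0.
have above (i : 'I_K) : (j < i)%N -> m i = m' i.
  by apply: contraTeq => /max_j; rewrite -leqNgt.
have [lt_j|lt_j|eq_j] := ltngtP (m j) (m' j); last by rewrite eq_j eqxx in neq_j.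
  by left; apply: (lacunary_weight_lt gapM dm lt_j above).
by right; apply: (lacunary_weight_lt gapM dm' lt_j) => i /above.
Qed.

End LacunaryWeights.

Section NonVanishing.
Local Open Scope ring_scope.

Lemma meval_neq0_of_lacunary_pval K p (P : {mpoly rat[K]}) : P != 0 ->
  exists2 M, (0 < M)%N &
    forall (V : nat -> nat) (x : 'I_K -> rat), lacunary K M V ->
    (forall i : 'I_K, pval p (x i) = - (V i.+1)%:Z) -> P.@[x] != 0.
Proof.
move=> P0; pose C := (\max_(m <- msupp P) `|pval p P@_m|)%N.
exists (K * msize P + (C + C)).+1 => // V x lacunaryV pval_x.
have coefC m : m \in msupp P -> (`|pval p P@_m| <= C)%N.
  by move=> mP; apply: (@leq_bigmax_seq _ _ _ (fun m => `|pval p P@_m|%N)).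
have x0 i : x i != 0.
  apply/eqP => xi0; have := lacunaryV i (ltn_ord i).
  by have := pval_x i; rewrite xi0 pval0; lia.
have termE m : m \in msupp P ->
    pval p (P@_m * \prod_i x i ^+ m i) = pval p P@_m - (weight V m)%:Z.
  move=> mP; rewrite pvalM -?mcoeff_msupp //; last first.
    by apply/prodf_neq0 => i _; rewrite expf_neq0.
  congr (_ + _); rewrite pval_prod => [|i]; last by rewrite expf_neq0.
  rewrite /weight (big_morph Posz PoszD (erefl _)) -sumrN; apply: eq_bigr => i _.
  by rewrite pvalX // pval_x mulNrn -mulr_natr PoszM natz.
rewrite mevalE (@sum_neq0_of_pval_injective p) ?msupp_eq0 ?msupp_uniq //= => [m mP|].
  by rewrite mulf_neq0 -?mcoeff_msupp //; apply/prodf_neq0 => i _; rewrite expf_neq0.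
move=> m m' mP m'P /=; rewrite !termE // => eq_val; apply/eqP/negPn/negP => neq_mm'.
have := coefC m mP; have := coefC m' m'P.
have := lacunary_weight_separated lacunaryV (ltnSn _) (ltnW (msize_mdeg_lt mP))
  (ltnW (msize_mdeg_lt m'P)) neq_mm'.
lia.
Qed.

End NonVanishing.

Section PartialSums.
Local Open Scope ring_scope.

Definition ratZ (z : Z) : rat := (int_of_Z z)%:~R.

Definition psum (a b : nat -> Z) (N : nat) : rat :=
  \sum_(1 <= n < N.+1) ratZ (b n) / ratZ (a n).

Lemma ratZ_eq0 z : (ratZ z == 0) = (z == Z0).
Proof. by rewrite intr_eq0 -[0]/(int_of_Z Z0) (can_eq int_of_ZK). Qed.

Lemma pval_ratZ p z : pval p (ratZ z) = nu p z.
Proof.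
have [->|z0] := eqVneq z Z0; first by rewrite pval0 /nu logn0.
rewrite pval_int -1?(intr_eq0 rat) -/(ratZ z) ?ratZ_eq0 //.
by have -> : `|int_of_Z z|%N = Z.abs_nat z by lia.
Qed.

Lemma nu_gt0_divide p z : (0 < nu p z)%N -> Z.divide (Z.of_nat p) z.
Proof.
rewrite /nu logn_gt0 mem_primes => /and3P [_ _ /dvdnP [q z_qp]].
apply/Z.divide_abs_r; exists (Z.of_nat q).
by rewrite -Zabs2Nat.id_abs z_qp Nat2Z.inj_mul.
Qed.

Lemma nu_le_maxnu p (a : nat -> Z) n N :
  (1 <= n <= N)%N -> (nu p (a n) <= maxnu p a N)%N.
Proof.
move=> nN; apply: (@leq_bigmax_seq _ _ _ (fun m => nu p (a m))) => //.
by rewrite mem_index_iota.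
Qed.

Lemma pval_psum p (a b : nat -> Z) N :
  (forall n, (1 <= n)%N -> a n <> Z0 /\ b n <> Z0 /\
     ~ Z.divide (Z.of_nat p) (Z.gcd (a n) (b n))) ->
  (exists! n, (1 <= n <= N)%N /\ nu p (a n) = maxnu p a N) ->
  (0 < maxnu p a N)%N -> pval p (psum a b N) = - (maxnu p a N)%:Z.
Proof.
move=> coprime_ab [n [[nN nu_n] uniq_n]] max_gt0.
have [a0 b0] : (forall m, (1 <= m)%N -> ratZ (a m) != 0) /\
               (forall m, (1 <= m)%N -> ratZ (b m) != 0).
  by split=> m /coprime_ab [am0 [bm0 _]]; rewrite ratZ_eq0; apply/eqP.
have pval_term m : (1 <= m)%N ->
    pval p (ratZ (b m) / ratZ (a m)) = (nu p (b m))%:Z - (nu p (a m))%:Z.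
  by move=> m1; rewrite pvalM ?invr_eq0 ?a0 ?b0 // pvalV !pval_ratZ.
have n1 : (1 <= n)%N by case/andP: nN.
have nu_bn : nu p (b n) = 0%N.
  apply/eqP; rewrite -leqn0 leqNgt; apply/negP => nu_b_gt0.
  have [_ [_]] := coprime_ab n n1; apply; apply: Z.gcd_greatest.
    by apply: nu_gt0_divide; rewrite nu_n.
  exact: nu_gt0_divide.
rewrite /psum (@pval_sum_unique_min p _ _ _ n) ?iota_uniq ?mem_index_iota //.
- by rewrite pval_term // nu_bn nu_n sub0r.
- by rewrite mulf_neq0 ?invr_eq0 ?a0 ?b0.
move=> m; rewrite mem_index_iota => mN neq_mn.
have m1 : (1 <= m)%N by case/andP: mN.
have : nu p (a m) != maxnu p a N.
  by apply: contra_neq neq_mn => nu_m; apply/esym/uniq_n.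
by rewrite !pval_term // nu_bn nu_n; have := nu_le_maxnu p a mN; lia.
Qed.

Lemma psum_denominator (a b : nat -> Z) N : (forall n, (1 <= n)%N -> a n <> Z0) ->
  psum a b N * \prod_(1 <= n < N.+1) ratZ (a n) \is a Num.int.
Proof.
move=> a0; rewrite /psum big_distrl big_seq rpred_sum //= => m.
rewrite mem_index_iota => mN; have am0 : ratZ (a m) != 0.
  by rewrite ratZ_eq0; apply/eqP/a0; case/andP: mN.
rewrite (bigD1_seq m) ?iota_uniq ?mem_index_iota //= mulrA divfK //.
by rewrite rpredM ?intr_int // rpred_prod // => n _; rewrite intr_int.
Qed.

End PartialSums.

Section RealPartialSums.
Local Open Scope R_scope.

Lemma IZR_ratZ z : IZR z = ratr (ratZ z).
Proof.
rewrite ratr_int -[z in LHS]int_of_ZK; case: (int_of_Z z) => n /=.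
  by rewrite -INR_IZR_INZ INRE.
by rewrite opp_IZR -INR_IZR_INZ INRE addn1.
Qed.

Lemma sum_f_R0_psum (a b : nat -> Z) N :
  sum_f_R0 (fun n => IZR (b n.+1) / IZR (a n.+1)) N = ratr (psum a b N.+1).
Proof.
have termE n : IZR (b n) / IZR (a n) = ratr (ratZ (b n) / ratZ (a n))%R.
  by rewrite rmorphM /= fmorphV /= -!IZR_ratZ RdivE.
rewrite /psum; elim: N => [|N IHN] /=; rewrite termE ?IHN; first by rewrite big_nat1.
by rewrite [in RHS](big_nat_recr N.+2) //= rmorphD.
Qed.

Lemma eventually_lacunary K (M : nat) (V : nat -> nat -> nat) :
  (forall k, (1 <= k <= K)%N -> forall x : R,
     eventually (fun N => x <= INR (V k N) / (1 + INR (V k.-1 N)))) ->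
  eventually (fun N => lacunary K M (V^~ N)).
Proof.
move=> growth.
have [N0 evN] :=
  eventually_forall (fun i : 'I_K => growth i.+1 (ltn_ord i) (INR M)).
exists N0 => N /evN ratio k kK; have /= := ratio (Ordinal kK).
move: (V k N) (V k.+1 N) => v w ratio_vw.
have v1_gt0 : 0 < 1 + INR v by have := pos_INR v; lra.
apply/ssrnat.leP/INR_le; rewrite mult_INR plus_INR /=.
apply: (Rle_trans _ _ _ (Rmult_le_compat_r _ _ _ (Rlt_le _ _ v1_gt0) ratio_vw)).
by apply: Req_le; field; lra.
Qed.

Lemma psum_not_root K p (a b : nat -> nat -> Z) (P : {mpoly rat[K]}) :
  (forall k n, (1 <= k <= K)%N -> (1 <= n)%N ->
     a k n <> Z0 /\ b k n <> Z0 /\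
     ~ Z.divide (Z.of_nat p) (Z.gcd (a k n) (b k n))) ->
  (forall k, (1 <= k <= K)%N -> eventually (fun N =>
     exists! n, (1 <= n <= N)%N /\ nu p (a k n) = maxnu p (a k) N)) ->
  (forall k, (1 <= k <= K)%N -> forall x : R, eventually (fun N =>
     x <= INR (maxnu p (a k) N) / (1 + INR (maxnu p (a k.-1) N)))) ->
  P != 0%R ->
  eventually (fun N => P.@[fun i : 'I_K => psum (a i.+1) (b i.+1) N] != 0%R).
Proof.
move=> coprime_ab uniq_max growth P0.
have [M M0 nonvanishing] := meval_neq0_of_lacunary_pval p P0.
have [N0 evN] := eventually_and (eventually_lacunary M growth)
  (eventually_forall (fun i : 'I_K => uniq_max i.+1 (ltn_ord i))).
exists N0 => N /evN [lacunaryV uniqN].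
apply: (nonvanishing _ _ lacunaryV) => i.
apply: pval_psum (uniqN i) _ => [n n1|]; first by apply: coprime_ab; rewrite ?ltn_ord.
by apply: leq_trans (lacunaryV i (ltn_ord i)); rewrite muln_gt0 M0.
Qed.

End RealPartialSums.

Section DominatedSeries.
Local Open Scope R_scope.

Lemma sum_f_R0_dist_telescope (u g : nat -> R) N m n :
  (forall k, (N < k)%N -> Rabs (u k) <= g k - g k.+1) -> (N <= m <= n)%N ->
  Rabs (sum_f_R0 u n - sum_f_R0 u m) <= g m.+1 - g n.+1.
Proof.
move=> u_le /andP [Nm]; elim: n => [|n IHn].
  by rewrite leqn0 => /eqP ->; rewrite !Rminus_diag Rabs_R0; lra.
rewrite leq_eqVlt => /predU1P [<-|mn]; first by rewrite !Rminus_diag Rabs_R0; lra.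
have := u_le n.+1 (leq_ltn_trans Nm mn); have := IHn mn.
have /= := Rabs_triang (sum_f_R0 u n - sum_f_R0 u m) (u n.+1).
have -> : sum_f_R0 u n - sum_f_R0 u m + u n.+1 = sum_f_R0 u n + u n.+1 - sum_f_R0 u m.
  by ring.
lra.
Qed.

Lemma infinite_sum_telescope_cv (u g : nat -> R) N :
  (forall k, (N < k)%N -> Rabs (u k) <= g k - g k.+1) ->
  (forall k, (N < k)%N -> 0 <= g k) -> exists l, infinite_sum u l.
Proof.
move=> u_le g_ge0.
suff [l] : {l | Un_cv (sum_f_R0 u) l} by exists l.
apply: cv_cauchy_2; apply: cauchy_abs; apply: cv_cauchy_1.
set S := sum_f_R0 _.
have S_growing : Un_growing S.
  by move=> n; rewrite /S /=; have := Rabs_pos (u n.+1); lra.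
apply: growing_cv => //; exists (S N + g N.+1) => _ [n ->].
have gN := g_ge0 N.+1 (ltnSn N); have [nN|Nn] := leqP n N.
  by have := growing_prop _ _ _ S_growing (ltac:(lia) : (N >= n)%coq_nat); lra.
have abs_le k : (N < k)%N -> Rabs (Rabs (u k)) <= g k - g k.+1.
  by rewrite Rabs_Rabsolu; apply: u_le.
have N_le : (N <= N <= n)%N by rewrite leqnn ltnW.
have := sum_f_R0_dist_telescope abs_le N_le; rewrite -/S.
have := Rle_abs (S n - S N); have := g_ge0 n.+1 (leqW Nn); lra.
Qed.

Lemma infinite_sum_telescope_tail (u g : nat -> R) N l : infinite_sum u l ->
  (forall k, (N < k)%N -> Rabs (u k) <= g k - g k.+1) ->
  (forall k, (N < k)%N -> 0 <= g k) -> Rabs (sum_f_R0 u N - l) <= g N.+1.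
Proof.
move=> u_l u_le g_ge0; apply: le_epsilon => e /u_l [M near_l].
have := near_l (N + M)%N ltac:(lia); rewrite /Rdist.
have N_le : (N <= N <= N + M)%N by rewrite leqnn leq_addr.
have := sum_f_R0_dist_telescope u_le N_le; rewrite Rabs_minus_sym.
have := g_ge0 (N + M).+1 (leq_addr _ _).
have := Rabs_triang (sum_f_R0 u N - sum_f_R0 u (N + M)) (sum_f_R0 u (N + M) - l).
have -> : sum_f_R0 u N - sum_f_R0 u (N + M) + (sum_f_R0 u (N + M) - l) =
  sum_f_R0 u N - l by ring.
lra.
Qed.

Lemma Rpower_le1 x y : 1 <= x -> y <= 0 -> Rpower x y <= 1.
Proof. by move=> x1 y0; rewrite -(Rpower_O x); [apply: Rle_Rpower | lra]. Qed.

Lemma Rpower_telescope s x : 0 < s -> 1 < x ->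
  s * Rpower x (- (1 + s)) <= Rpower (x - 1) (- s) - Rpower x (- s).
Proof.
move=> s0 x1; have xV0 : 0 < / x by apply: Rinv_0_lt_compat; lra.
have q0 : 0 < (x - 1) * / x by apply: Rmult_lt_0_compat; lra.
have -> : Rpower (x - 1) (- s) = Rpower x (- s) * Rpower ((x - 1) * / x) (- s).
  by rewrite Rpower_mult_distr; [congr Rpower; field; lra | lra | done].
have -> : Rpower x (- (1 + s)) = Rpower x (- s) * / x.
  by rewrite Ropp_plus_distr Rplus_comm Rpower_plus (Rpower_Ropp x 1) Rpower_1; lra.
suff : s * / x + 1 <= Rpower ((x - 1) * / x) (- s).
  by have := exp_pos (- s * ln x); rewrite -/(Rpower x (- s)); nra.
have ln_le : ln ((x - 1) * / x) <= - / x.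
  have := exp_ineq1_le (ln ((x - 1) * / x)); rewrite exp_ln //.
  have -> : (x - 1) * / x = 1 - / x by field; lra.
  lra.
by rewrite /Rpower; apply: Rle_trans (exp_ineq1_le _); nra.
Qed.

(* The terms are compared with [E N.+1 * n.+1 ^ - (1 + s)], hence with the increments of
   [E N.+1 / s * n ^ - s]. *)
Lemma infinite_sum_Rpower_dominated (u E : nat -> R) s : 0 < s ->
  (forall n, 0 <= E n) -> Un_decreasing E ->
  eventually (fun n => Rabs (u n) <= E n * Rpower (INR n.+1) (- (1 + s))) ->
  exists2 l, infinite_sum u l &
    eventually (fun N => Rabs (sum_f_R0 u N - l) <= E N.+1 / s).
Proof.
move=> s0 E0 E_decr [n0 u_le]; pose g N n := E N.+1 / s * Rpower (INR n) (- s).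
have Es0 N : 0 <= E N.+1 / s.
  by apply: Rmult_le_pos => //; exact/Rlt_le/Rinv_0_lt_compat.
have g_ge0 N n : 0 <= g N n by apply: Rmult_le_pos => //; exact/Rlt_le/exp_pos.
have u_telescope N n : (n0 <= N)%N -> (N < n)%N -> Rabs (u n) <= g N n - g N n.+1.
  move=> n0N Nn; apply: Rle_trans (u_le n (leq_trans n0N (ltnW Nn))) _.
  have E_le : E n <= E N.+1 by apply: decreasing_prop => //; lia.
  have n1 : 1 < INR n.+1 by rewrite S_INR; have := lt_0_INR n ltac:(lia); lra.
  have := Rpower_telescope s0 n1.
  have -> : INR n.+1 - 1 = INR n by rewrite S_INR; ring.
  move=> /(Rmult_le_compat_l _ _ _ (Es0 N)) tele.
  rewrite /g -Rmult_minus_distr_l; apply: Rle_trans tele.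
  have -> : E N.+1 / s * (s * Rpower (INR n.+1) (- (1 + s))) =
    E N.+1 * Rpower (INR n.+1) (- (1 + s)) by field; lra.
  by apply: Rmult_le_compat_r => //; exact/Rlt_le/exp_pos.
have [l u_l] := infinite_sum_telescope_cv (fun n => u_telescope n0 n (leqnn n0))
  (fun n _ => g_ge0 n0 n).
exists l => //; exists n0 => N n0N.
have := infinite_sum_telescope_tail u_l (fun n => u_telescope N n n0N)
  (fun n _ => g_ge0 N n).
move=> /Rle_trans; apply; rewrite /g -[X in _ <= X]Rmult_1_r.
apply: Rmult_le_compat_l => //; apply: Rpower_le1; last lra.
by rewrite S_INR; have := pos_INR N; lra.
Qed.

End DominatedSeries.

Section BinaryLogarithm.
Local Open Scope R_scope.

Lemma ln2_gt0 : 0 < ln 2.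
Proof. by have := ln_lt_2; lra. Qed.

Lemma log2_1 : log2 1 = 0.
Proof. by rewrite /log2 ln_1; field; have := ln2_gt0; lra. Qed.

Lemma log2_Rpower x y : log2 (Rpower x y) = y * log2 x.
Proof. by rewrite /log2 /Rpower ln_exp; field; have := ln2_gt0; lra. Qed.

Lemma log2_Rpower2 y : log2 (Rpower 2 y) = y.
Proof. by rewrite log2_Rpower /log2; field; have := ln2_gt0; lra. Qed.

Lemma Rpower2_log2 x : 0 < x -> Rpower 2 (log2 x) = x.
Proof.
move=> x0; rewrite /Rpower /log2 /Rdiv Rmult_assoc Rinv_l ?Rmult_1_r ?exp_ln //.
by have := ln2_gt0; lra.
Qed.

Lemma log2_mult x y : 0 < x -> 0 < y -> log2 (x * y) = log2 x + log2 y.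
Proof. by move=> x0 y0; rewrite /log2 ln_mult // Rdiv_plus_distr. Qed.

Lemma log2_le x y : 0 < x -> x <= y -> log2 x <= log2 y.
Proof.
move=> x0 xy; apply: Rmult_le_compat_r; first exact/Rlt_le/Rinv_0_lt_compat/ln2_gt0.
by case: xy => [xy|->]; [apply/Rlt_le/ln_increasing | exact: Rle_refl].
Qed.

Lemma log2_INR_ge0 n : 0 <= log2 (INR n).
Proof.
case: n => [|n]; last first.
  by rewrite -log2_1; apply: log2_le; rewrite ?S_INR; have := pos_INR n; lra.
rewrite /log2 /ln /=; case: Rlt_dec => [/Rlt_irrefl //|_]; lra.
Qed.

Lemma Rpower2_le x y : x <= y -> Rpower 2 x <= Rpower 2 y.
Proof. by move=> xy; apply: Rle_Rpower; lra. Qed.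

Lemma INR_expn m n : INR (m ^ n) = INR m ^ n.
Proof. by rewrite RpowE !INRE natrX. Qed.

Lemma limsup_root_not_exponential (v : nat -> R) (B : nat) : (0 < B)%N ->
  (forall (M : R) (N0 : nat), exists n, (N0 <= n)%N /\
     M <= Rpower (v n) (/ INR (B ^ n)%N)) ->
  ~ exists C, eventually (fun n => log2 (v n) <= C * INR B ^ n).
Proof.
move=> B0 unbounded [C [N log2_le_C]].
have [n [Nn]] := unbounded (Rpower 2 (C + 1)) N.
move=> /(log2_le (exp_pos _)); rewrite log2_Rpower2 log2_Rpower INR_expn => root_gt.
have Bn0 : 0 < INR B ^ n by apply: pow_lt; apply: lt_0_INR; lia.
have := Rmult_le_compat_r _ _ _ (Rlt_le _ _ Bn0) root_gt.
have -> : / INR B ^ n * log2 (v n) * INR B ^ n = log2 (v n) by field; lra.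
have := log2_le_C n Nn; lra.
Qed.

End BinaryLogarithm.

Section ControlledGrowth.
Local Open Scope R_scope.

Lemma Rpower_sublinear kappa eta : kappa < 1 -> 0 < eta ->
  exists x0, forall x, x0 <= x -> Rpower x kappa <= eta * x.
Proof.
move=> kappa1 eta0; pose x0 := Rpower (/ eta) (/ (1 - kappa)).
have x0_gt0 : 0 < x0 by exact: exp_pos.
exists x0 => x x0_le.
have etaV : / eta <= Rpower x (1 - kappa).
  have -> : / eta = Rpower x0 (1 - kappa).
    by rewrite Rpower_mult Rinv_l ?Rpower_1 //; [apply: Rinv_0_lt_compat | lra].
  by apply: Rle_Rpower_l; lra.
have xE : x = Rpower x (1 - kappa) * Rpower x kappa.
  by rewrite -Rpower_plus Rplus_assoc Rplus_opp_l Rplus_0_r Rpower_1; lra.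
rewrite {2}xE -Rmult_assoc -[X in X <= _]Rmult_1_l.
apply: Rmult_le_compat_r; first exact/Rlt_le/exp_pos.
have := Rmult_le_compat_l _ _ _ (Rlt_le _ _ eta0) etaV.
by rewrite Rinv_r //; lra.
Qed.

Variables (eps kappa : R) (A : nat) (an : nat -> nat) (a b : nat -> Z).

Local Notation L n := (log2 (INR (an n))).

Definition controlled_growth : Prop := eventually (fun n =>
  Rpower (INR n) (1 + eps) <= INR (an n) /\ (an n <= an n.+1)%N /\
  IZR (Z.abs (b n)) <= Rpower 2 (Rpower (L n) kappa) /\
  INR (an n) * Rpower 2 (- Rpower (L n) kappa) <= IZR (Z.abs (a n)) /\
  IZR (Z.abs (a n)) <=
    Rmax (INR (an n) * Rpower 2 (Rpower (L n) kappa)) (2 ^ (A ^ n)%N)).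

(* Half of the surplus [eps] makes the series converge, since
   [(1 + eps) * (1 - 2 * decay_rate) = 1 + eps / 2]; the rest gives decay in [an n]. *)
Definition decay_rate : R := eps / (4 * (1 + eps)).

Lemma decay_rate_gt0 : 0 < eps -> 0 < decay_rate.
Proof. by move=> eps_gt0; apply: Rdiv_lt_0_compat; lra. Qed.

Hypotheses (eps_gt0 : 0 < eps) (kappa_lt1 : kappa < 1).
Hypothesis an_gt0 : forall n, (1 <= n)%N -> (0 < an n)%N.
Hypothesis growth : controlled_growth.

Lemma Rpower2_log2_an n : (1 <= n)%N -> Rpower 2 (L n) = INR (an n).
Proof. by move=> n1; apply: Rpower2_log2; apply: lt_0_INR; have := an_gt0 n1; lia. Qed.

Lemma eventually_log2_an_ge x : eventually (fun n => x <= L n).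
Proof.
have [m m_gt] := INR_unbounded (Rpower 2 x); have [n0 growth_n] := growth.
exists (maxn n0 m.+1) => n; rewrite geq_max => /andP [/growth_n [n_le _] mn].
have mn_INR : INR m <= INR n by apply: le_INR; lia.
have x_le : x <= log2 (INR n).
  by rewrite -[X in X <= _]log2_Rpower2; apply: log2_le; [exact: exp_pos | lra].
apply: Rle_trans (log2_le (exp_pos _) n_le); rewrite log2_Rpower.
by have := log2_INR_ge0 n; nra.
Qed.

Lemma controlled_growth_term_decay : eventually (fun n =>
  Rabs (IZR (b n) / IZR (a n)) <=
  Rpower 2 (- (decay_rate * L n)) * Rpower (INR n) (- (1 + eps / 2))).
Proof.
have rateE : (1 + eps) * (1 - 2 * decay_rate) = 1 + eps / 2.
  by rewrite /decay_rate; field; lra.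
have rate_half : 0 < decay_rate / 2 by have := decay_rate_gt0 eps_gt0; lra.
have [x0 sublinear] := Rpower_sublinear kappa_lt1 rate_half.
have [n0 bounds] := eventually_and growth
  (eventually_and (eventually_log2_an_ge x0) (eventually_ge 1)).
exists n0 => n /bounds [[n_le [_ [b_le [a_ge _]]]] [/sublinear xkappa_le n1]].
set x := L n in b_le a_ge xkappa_le *.
rewrite -Rpower2_log2_an // -/x -?Rpower_plus ?abs_IZR in n_le b_le a_ge.
have a0 : 0 < Rabs (IZR (a n)) by apply: Rlt_le_trans a_ge; exact: exp_pos.
have quotient_le : Rabs (IZR (b n) / IZR (a n)) <= Rpower 2 (- ((1 - decay_rate) * x)).
  apply: (Rmult_le_reg_r (Rabs (IZR (a n)))) => //.
  rewrite /Rdiv Rabs_mult Rabs_inv Rmult_assoc Rinv_l ?Rmult_1_r; last lra.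
  apply: Rle_trans (Rmult_le_compat_l _ _ _ (Rlt_le _ _ (exp_pos _)) a_ge).
  by apply: Rle_trans b_le _; rewrite -Rpower_plus; apply: Rpower2_le; lra.
apply: Rle_trans quotient_le _.
have -> : - ((1 - decay_rate) * x) = - (decay_rate * x) + - (x * (1 - 2 * decay_rate)).
  by ring.
rewrite Rpower_plus; apply: Rmult_le_compat_l; first exact/Rlt_le/exp_pos.
rewrite !Rpower_Ropp -rateE -(Rpower_mult 2 x) -Rpower_mult.
apply: Rinv_le_contravar; first exact: exp_pos.
by apply: Rle_Rpower_l; [nra | split=> //; exact: exp_pos].
Qed.

Lemma controlled_growth_denominator : eventually (fun n =>
  Rabs (IZR (a n)) <= Rpower 2 (2 * L n + INR A ^ n)).
Proof.
have [n0 bounds] := eventually_and growth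
  (eventually_and (eventually_log2_an_ge 1) (eventually_ge 1)).
exists n0 => n /bounds [[_ [_ [_ [_ a_le]]]] [x1 n1]]; set x := L n in a_le x1 *.
rewrite -Rpower2_log2_an // -/x -Rpower_plus abs_IZR in a_le.
have xkappa_le : Rpower x kappa <= x.
  by rewrite -[X in _ <= X]Rpower_1; [apply: Rle_Rpower; lra | lra].
apply: Rle_trans a_le _; rewrite -INR_expn; have An := pos_INR (A ^ n).
by apply: Rmax_lub; [|rewrite -Rpower_pow; last lra]; apply: Rpower2_le; lra.
Qed.

Hypothesis an_homo : forall n, (1 <= n)%N -> (an n <= an n.+1)%N.

Lemma controlled_growth_series : exists2 l,
  infinite_sum (fun n => IZR (b n.+1) / IZR (a n.+1)) l &
  eventually (fun N =>
    Rabs (ratr (psum a b N) - l) <= 2 / eps * Rpower 2 (- (decay_rate * L N.+1))).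
Proof.
pose E n := Rpower 2 (- (decay_rate * L n.+1)).
have E_ge0 n : 0 <= E n by exact/Rlt_le/exp_pos.
have E_decr : Un_decreasing E.
  move=> n; apply: Rpower2_le; apply/Ropp_le_contravar/Rmult_le_compat_l.
    exact/Rlt_le/decay_rate_gt0.
  apply: log2_le; first by apply: lt_0_INR; apply/ssrnat.ltP/an_gt0.
  by apply: le_INR; apply/ssrnat.leP/an_homo.
have term_le : eventually (fun n => Rabs (IZR (b n.+1) / IZR (a n.+1)) <=
    E n * Rpower (INR n.+1) (- (1 + eps / 2))).
  by have [n0 term_le] := controlled_growth_term_decay; exists n0 => n /leqW /term_le.
have eps2_gt0 : 0 < eps / 2 by lra.
have [l sum_l [n1 tail_le]] :=
  infinite_sum_Rpower_dominated eps2_gt0 E_ge0 E_decr term_le.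
exists l => //; exists n1.+1 => -[//|N] N_ge.
rewrite -sum_f_R0_psum; apply: Rle_trans (tail_le N N_ge) _.
by apply: Req_le; rewrite /E; field; lra.
Qed.

End ControlledGrowth.

Section Denominators.
Local Open Scope R_scope.

Lemma prod_ratZ_le (a : nat -> Z) (w : nat -> R) :
  eventually (fun n => Rabs (IZR (a n)) <= Rpower 2 (w n)) ->
  exists G, eventually (fun N =>
    Rabs (ratr (\prod_(1 <= n < N.+1) ratZ (a n))) <= G * Rpower 2 (sum_f_R0 w N)).
Proof.
move=> [n0 a_le]; pose q N := Rabs (ratr (\prod_(1 <= n < N.+1) ratZ (a n))%R).
have qS N : q N.+1 = q N * Rabs (IZR (a N.+1)).
  by rewrite /q (big_nat_recr N.+1) //= rmorphM /= -Rabs_mult -IZR_ratZ.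
have Rpower2_mulNK x t : x * Rpower 2 (- t) * Rpower 2 t = x.
  by rewrite Rmult_assoc -Rpower_plus Rplus_opp_l Rpower_O; lra.
exists (q n0 * Rpower 2 (- sum_f_R0 w n0)), n0 => N; rewrite -/(q N).
elim: N => [|N IHN]; first by rewrite leqn0 => /eqP ->; rewrite Rpower2_mulNK; lra.
rewrite leq_eqVlt => /predU1P [<-|n0N]; first by rewrite Rpower2_mulNK; lra.
rewrite qS /= Rpower_plus -Rmult_assoc.
by apply: Rmult_le_compat; [exact: Rabs_pos | exact: Rabs_pos | exact: IHN |
  apply: a_le; exact: ltnW].
Qed.

Variables (K : nat) (a : nat -> nat -> Z).

Definition denominator_product (N : nat) : rat :=
  (\prod_(i < K) \prod_(1 <= n < N.+1) ratZ (a i.+1 n))%R.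

Lemma denominator_product_le (w : nat -> R) :
  (forall i : 'I_K, eventually (fun n => Rabs (IZR (a i.+1 n)) <= Rpower 2 (w n))) ->
  exists G, eventually (fun N =>
    Rabs (ratr (denominator_product N)) <= G * Rpower 2 (INR K * sum_f_R0 w N)).
Proof.
move=> a_le.
have /fin_all_exists [G /eventually_forall [n0 prod_le]] :=
  fun i => prod_ratZ_le (a_le i).
exists (\prod_(i < K) G i)%R, n0 => N /prod_le {}prod_le.
have -> : Rpower 2 (INR K * sum_f_R0 w N) = Rpower 2 (sum_f_R0 w N) ^ K.
  by rewrite Rmult_comm -Rpower_mult Rpower_pow //; exact: exp_pos.
rewrite /denominator_product rmorph_prod RabsE normr_prod RpowE RmultE.
rewrite -[X in (_ ^+ X)%R]card_ord -prodr_const -big_split /=; apply/RleP.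
by apply: ler_prod => i _; rewrite normr_ge0 -RabsE; apply/RleP.
Qed.

Lemma denominator_product_common (b : nat -> nat -> Z) N :
  (forall k n, (1 <= k <= K)%N -> (1 <= n)%N -> a k n <> Z0) ->
  is_common_denominator (fun i : 'I_K => psum (a i.+1) (b i.+1) N)
    (denominator_product N).
Proof.
move=> a_neq0; have a_row i : (i < K)%N -> forall n, (1 <= n)%N -> a i.+1 n <> Z0.
  by move=> iK n; apply: a_neq0.
have int_prod (I : eqType) (r : seq I) (Q : pred I) (F : I -> nat -> Z) :
    (\prod_(i <- r | Q i) \prod_(1 <= n < N.+1) ratZ (F i n))%R \is a Num.int.
  by do 2![apply: rpred_prod => ? _]; exact: intr_int.
split=> [||i]; first exact: int_prod.
  apply/prodf_neq0 => i _; rewrite prodf_seq_neq0; apply/allP => n.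
  rewrite mem_index_iota ratZ_eq0 /= => /andP [n1 _].
  by apply/eqP/a_row.
rewrite /denominator_product (bigD1 i) //= mulrA rpredM ?int_prod //.
by apply: psum_denominator; apply: a_row.
Qed.

End Denominators.

Section ApproximationExponent.
Local Open Scope R_scope.

Lemma approximation_exponent_le K (P : {mpoly rat[K]}) (alpha : 'I_K -> R)
    (x : nat -> 'I_K -> rat) (D : nat -> rat) (delta tau : nat -> R) (E G : R) :
  (map_mpoly ratr P).@[alpha] = 0%R ->
  eventually (fun N => P.@[x N] != 0%R) ->
  (forall N, is_common_denominator (x N) (D N)) ->
  0 <= E -> (forall N, 0 <= delta N) ->
  eventually (fun N => forall i,
    Rabs (ratr (x N i) - alpha i) <= E * Rpower 2 (- delta N)) ->
  eventually (fun N => Rabs (ratr (D N)) <= G * Rpower 2 (tau N)) ->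
  exists c, eventually (fun N => delta N <= c + INR (msize P) * tau N).
Proof.
move=> Palpha Px0 xD E0 delta0 x_near D_le.
have [C C0 approx] := root_approximation_lower_bound E Palpha.
pose c := C * E * G ^ msize P; exists (log2 c).
have [n0 bounds] := eventually_and Px0 (eventually_and x_near D_le).
exists n0 => N /bounds [PxN0 [near_N DN_le]].
have pow_gt0 y : 0 < Rpower 2 y by exact: exp_pos.
have d_le : E * Rpower 2 (- delta N) <= E.
  rewrite -[X in _ <= X]Rmult_1_r; apply: Rmult_le_compat_l => //.
  by rewrite -(Rpower_O 2); [apply: Rpower2_le; have := delta0 N; lra | lra].
have d_ge0 : 0 <= E * Rpower 2 (- delta N) by apply: Rmult_le_pos => //; apply/Rlt_le.
have one_le : 1 <= c * Rpower 2 (- delta N + INR (msize P) * tau N).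
  have d_bounds : (0 <= E * Rpower 2 (- delta N) <= E)%R.
    by apply/andP; split; apply/RleP.
  have {}near_N i : (`|ratr (x N i) - alpha i| <= E * Rpower 2 (- delta N))%R.
    by rewrite -RabsE; apply/RleP/near_N.
  have /RleP := approx _ _ _ (xD N) PxN0 d_bounds near_N.
  rewrite -RabsE -RpowE => /Rle_trans; apply.
  have pow_le_G : Rabs (ratr (D N)) ^ msize P <= (G * Rpower 2 (tau N)) ^ msize P.
    by apply: pow_incr; split=> //; exact: Rabs_pos.
  apply: (Rle_trans _ _ _ (Rmult_le_compat_l _ _ _ _ pow_le_G)).
    by apply: Rmult_le_pos => //; apply/Rlt_le/RltP.
  rewrite Rpow_mult_distr -(Rpower_pow _ _ (pow_gt0 _)) Rpower_mult Rpower_plus /c.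
  by rewrite (Rmult_comm (tau N)); apply: Req_le; rewrite -!RmultE; ring.
have c0 : 0 < c by have := pow_gt0 (- delta N + INR (msize P) * tau N); nra.
have := log2_le Rlt_0_1 one_le.
rewrite log2_1 log2_mult // log2_Rpower2; lra.
Qed.

End ApproximationExponent.

Section ExponentialRecurrence.
Local Open Scope R_scope.

Lemma linear_recurrence_exponential (U : nat -> R) q r B N :
  1 <= q -> 0 <= r -> q + r <= B ->
  (forall n, (N <= n)%N -> U n.+1 <= q * U n + r ^ n.+1) ->
  exists2 C, 0 <= C & forall n, (N <= n)%N -> U n <= C * B ^ n.
Proof.
move=> q1 r0 qrB step; have B1 : 1 <= B by lra.
pose C := Rmax 1 (U N); have C1 : 1 <= C by exact: Rmax_l.
have UN_le : U N <= C * B ^ N.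
  have := pow_R1_Rle B N B1; have : U N <= C by exact: Rmax_r.
  nra.
exists C => [|n]; first lra.
elim: n => [|n IHn]; first by rewrite leqn0 => /eqP <-.
rewrite leq_eqVlt => /predU1P [<- //|Nn]; apply: Rle_trans (step n Nn) _.
have r_pow : r ^ n <= C * B ^ n.
  have : r ^ n <= B ^ n by apply: pow_incr; lra.
  by have := pow_R1_Rle B n B1; nra.
have CB0 : 0 <= C * B ^ n by apply: Rmult_le_pos; [lra | apply: pow_le; lra].
have := Rmult_le_compat_r _ _ _ CB0 qrB; have := Rmult_le_compat_l _ _ _ r0 r_pow.
by have := Rmult_le_compat_l q _ _ ltac:(lra) (IHn Nn); rewrite /=; lra.
Qed.

Lemma partial_sum_recurrence_exponential (L : nat -> R) A eta c e :
  0 <= A -> (forall n, 0 <= L n) -> 0 < eta ->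
  eventually (fun N =>
    eta * L N.+1 <= c + e * sum_f_R0 (fun n => 2 * L n + A ^ n) N) ->
  exists q, forall B, q <= B -> exists C, eventually (fun n => L n <= C * B ^ n).
Proof.
move=> A0 L0 eta0 [N rec]; pose T := sum_f_R0 (fun n => 2 * L n + A ^ n).
have T0 n : 0 <= T n.
  by apply: cond_pos_sum => m; have := L0 m; have := pow_le A m A0; lra.
pose D := (Rabs c + Rabs e) / eta; have c_abs := Rabs_pos c; have e_abs := Rabs_pos e.
have D0 : 0 <= D by apply: Rmult_le_pos; [lra | exact/Rlt_le/Rinv_0_lt_compat].
have L_le n : (N <= n)%N -> L n.+1 <= D * (1 + T n).
  move=> /rec; rewrite -/T => rec_n; apply: (Rmult_le_reg_l eta) => //.
  have -> : eta * (D * (1 + T n)) = (Rabs c + Rabs e) * (1 + T n).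
    by rewrite /D; field; lra.
  have := Rle_abs c; have := Rle_abs e; have := T0 n; nra.
exists (1 + 2 * D + A) => B B_ge.
have [|//|//|n Nn|C C0 U_le] := @linear_recurrence_exponential (fun n => 1 + T n)
  (1 + 2 * D) A B N; first lra.
  by have := L_le n Nn; rewrite /T /=; lra.
exists (D * C), N.+1 => -[//|n] Nn; apply: Rle_trans (L_le n Nn) _.
rewrite Rmult_assoc; apply: Rmult_le_compat_l => //; apply: Rle_trans (U_le n Nn) _.
by apply: Rmult_le_compat_l => //; apply: Rle_pow; [lra | lia].
Qed.

Lemma algebraic_relation_exponential K (P : {mpoly rat[K]}) (alpha : 'I_K -> R)
    (x : nat -> 'I_K -> rat) (D : nat -> rat) (L : nat -> R) A d eta E G :
  (map_mpoly ratr P).@[alpha] = 0%R ->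
  eventually (fun N => P.@[x N] != 0%R) ->
  (forall N, is_common_denominator (x N) (D N)) ->
  0 <= A -> 0 < eta -> 0 <= E -> (forall n, 0 <= L n) ->
  eventually (fun N => forall i,
    Rabs (ratr (x N i) - alpha i) <= E * Rpower 2 (- (eta * L N.+1))) ->
  eventually (fun N => Rabs (ratr (D N)) <=
    G * Rpower 2 (d * sum_f_R0 (fun n => 2 * L n + A ^ n) N)) ->
  exists q, forall B, q <= B -> exists C, eventually (fun n => L n <= C * B ^ n).
Proof.
move=> Palpha Px0 xD A0 eta0 E0 L0 x_near D_le.
have delta0 N : 0 <= eta * L N.+1 by apply: Rmult_le_pos; [lra | exact: L0].
have [c [n0 exponent_le]] :=
  approximation_exponent_le Palpha Px0 xD E0 delta0 x_near D_le.
apply: (@partial_sum_recurrence_exponential L A eta c (INR (msize P) * d)) => //.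
by exists n0 => N /exponent_le; rewrite Rmult_assoc.
Qed.

End ExponentialRecurrence.

Open Scope R_scope.

Theorem theorem2 (K p : nat) (eps kappa : R) (a b : nat -> nat -> Z)
  (an : nat -> nat) (A0 : nat) :
  (0 < K)%N -> prime p ->
  (0 < eps) -> (0 < kappa) -> (kappa < 1) ->
  (forall k n, (1 <= k <= K)%N -> (1 <= n)%N ->
     a k n <> Z0 /\ b k n <> Z0 /\
     ~ (Z.divide (Z.of_nat p) (Z.gcd (a k n) (b k n)))) ->
  (forall n, a 0%N n = (Zpos xH)) ->
  (forall k, (1 <= k <= K)%N -> exists N0, forall N, (N0 <= N)%N ->
     exists! n, (1 <= n <= N)%N /\ nu p (a k n) = maxnu p (a k) N) ->
  (forall k, (1 <= k <= K)%N -> forall M : R, exists N0, forall N, (N0 <= N)%N ->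
     (M <= INR (maxnu p (a k) N) / (1 + INR (maxnu p (a k.-1) N)))) ->
  (forall n, (1 <= n)%N -> (0 < an n)%N) ->
  (forall n, (1 <= n)%N -> (an n <= an n.+1)%N) ->
  (forall k, (1 <= k <= K)%N -> forall A : nat, (A0 <= A)%N -> (0 < A)%N ->
     exists n0, forall n, (n0 <= n)%N ->
       (Rpower (INR n) (1 + eps) <= INR (an n)) /\ (an n <= an n.+1)%N /\
       (IZR (Z.abs (b k n)) <= Rpower 2 (Rpower (log2 (INR (an n))) kappa)) /\
       (INR (an n) * Rpower 2 (- Rpower (log2 (INR (an n))) kappa)
          <= IZR (Z.abs (a k n))) /\
       (IZR (Z.abs (a k n)) <=
          Rmax (INR (an n) * Rpower 2 (Rpower (log2 (INR (an n))) kappa))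
               (2 ^ (A ^ n)%N))) ->
  (forall A : nat, (A0 <= A)%N -> (0 < A)%N ->
     forall (M : R) (N0 : nat), exists n, (N0 <= n)%N /\
       (M <= Rpower (INR (an n)) (/ INR (A ^ n)%N))) ->
  exists alpha : 'I_K -> R,
    (forall i : 'I_K,
       infinite_sum (fun n => (IZR (b i.+1 n.+1) / IZR (a i.+1 n.+1))) (alpha i))
    /\ alg_indep alpha.
Proof.
move=> _ _ eps0 _ kappa1 coprime_ab _ uniq_max ratio_limit an_gt0 an_homo growth.
move=> root_limsup.
have growth_i (i : 'I_K) : controlled_growth eps kappa A0.+1 an (a i.+1) (b i.+1).
  by apply: growth; rewrite ?ltn_ord.
have [alpha alpha_sum alpha_near] := fin_all_exists2 (fun i : 'I_K =>
  controlled_growth_series eps0 kappa1 an_gt0 (growth_i i) an_homo).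
exists alpha; split=> // P P0 Palpha.
have a_neq0 k n : (1 <= k <= K)%N -> (1 <= n)%N -> a k n <> Z0.
  by move=> kK n1; have [] := coprime_ab k n kK n1.
have [G denominator_le] := denominator_product_le (fun i : 'I_K =>
  controlled_growth_denominator eps0 kappa1 an_gt0 (growth_i i)).
have [q log2_an_le] := algebraic_relation_exponential Palpha
  (psum_not_root coprime_ab uniq_max ratio_limit P0)
  (fun N => denominator_product_common b N a_neq0) (pos_INR A0.+1) (decay_rate_gt0 eps0)
  (Rlt_le _ _ (Rdiv_lt_0_compat _ _ Rlt_0_2 eps0)) (fun n => log2_INR_ge0 (an n))
  (eventually_forall alpha_near) denominator_le.
have [B B_gt] := INR_unbounded q.
have B_ge : q <= INR (A0 + B).+1.
  by rewrite S_INR plus_INR; have := pos_INR A0; lra.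
apply: (limsup_root_not_exponential _ _ (log2_an_le _ B_ge)) => //.
by apply: root_limsup => //; apply: leqW; apply: leq_addr.
Qed.
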